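(* Let $z_1,z_2,\dots,z_n$ be complex numbers with arithmetic mean $\widetilde z=\frac1n\sum_{i=1}^n z_i$. If all the $z_i$ lie on a circle in the complex plane with centre $\widetilde z$ and radius $r_z$, i.e. $|z_i-\widetilde z|=r_z$ for all $i=1,\dots,n$, then $r_z$ is the radius of the smallest disk containing all the points $z_1,\dots,z_n$.
   Context: The smallest disk containing a finite set of points of $\mathbb{C}$ is the closed disk of minimal radius that contains all of them. *)

(* Defs.v *)
From mathcomp Require Export all_boot all_order all_algebra.
From mathcomp Require Export complex.
From mathcomp Require Export classical_sets reals.
Import Order.TTheory GRing.Theory Num.Theory.
Local Open Scope ring_scope.
Local Open Scope complex_scope.
Local Open Scope classical_set_scope.

Set Implicit Arguments.
Unset Strict Implicit.
Unset Printing Implicit Defensive.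

Definition arith_mean (R : realType) (n : nat) (z : 'I_n -> R[i]) : R[i] :=
  n%:R^-1 * \sum_(i < n) z i.

(* Not the library's [closed_ball], the closure of an open ball, which is empty
   for radius 0; a disk of radius 0 has to be its centre, because it is the
   smallest disk containing a single point. *)
Definition closed_disk (R : realType) (c : R[i]) (r : R) : set R[i] :=
  [set w | `|w - c| <= r%:C].

Definition smallest_disk (R : realType) (A : set R[i]) (c : R[i]) (r : R) :
    Prop :=
  [/\ 0 <= r, A `<=` closed_disk c r
    & forall (c' : R[i]) (r' : R),
        0 <= r' -> A `<=` closed_disk c' r' -> r <= r'].

Definition smallest_disk_radius (R : realType) (A : set R[i]) (r : R) : Prop :=
  exists c : R[i], smallest_disk A c r.

(* Main.v *)
Require Import Defs.
From mathcomp Require Import ring.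
Import Order.TTheory GRing.Theory Num.Theory.
Local Open Scope ring_scope.
Local Open Scope complex_scope.
Local Open Scope classical_set_scope.

(** The mean square distance to a point [c'] decomposes as the mean square
    distance to the barycentre plus the squared distance from the barycentre to
    [c'] (the Huygens, or parallel axis, identity, [sum_sqr_norm_centred]).
    Here the first term equals [rz ^+ 2], since all the points lie on the circle, whereas the mean square
    distance to the centre of any enclosing disk of radius [r'] is at most
    [r' ^+ 2].  Hence [rz <= r'], and the disk bounded by the circle attains
    this bound. *)

(** The cross terms vanish because the points [w i] are centred. *)
Lemma sum_sqr_norm_centred (C : numClosedFieldType) (I : finType)
    (w : I -> C) (d : C) :
  \sum_i w i = 0 ->
  \sum_i `|w i - d| ^+ 2 = \sum_i `|w i| ^+ 2 + `|d| ^+ 2 *+ #|I|.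
Proof.
move=> w_centred.
have expand i : `|w i - d| ^+ 2 =
    `|w i| ^+ 2 + `|d| ^+ 2 - w i * Num.conj d - Num.conj (w i) * d.
  by rewrite !normCK rmorphB /=; ring.
rewrite (eq_bigr _ (fun i _ => expand i)) !sumrB big_split /= sumr_const.
by rewrite -!mulr_suml -rmorph_sum w_centred rmorph0 !mul0r !subr0.
Qed.

Lemma sum_sub_arith_mean (R : realType) (n : nat) (z : 'I_n -> R[i]) :
  (0 < n)%N -> \sum_i (z i - arith_mean z) = 0.
Proof.
move=> n_gt0; rewrite sumrB sumr_const card_ord -mulr_natl mulVKf ?subrr //.
by rewrite pnatr_eq0 -lt0n.
Qed.

Theorem theorem2p1 (R : realType) (n : nat) (z : 'I_n -> R[i]) (rz : R)
  (n_gt0 : (0 < n)%N)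
  (z_circle : forall i : 'I_n, `|z i - arith_mean z| = rz%:C) :
  smallest_disk_radius (range z) rz.
Proof.
have rz_ge0 : 0 <= rz by rewrite -ler0c -(z_circle (Ordinal n_gt0)) normr_ge0.
exists (arith_mean z); split=> // [_ [i _ <-]|c' r' r'_ge0 z_in_disk].
  by rewrite /closed_disk /= z_circle.
have sum_sqr_le : rz%:C ^+ 2 *+ n <= r'%:C ^+ 2 *+ n.
  have huygens := sum_sqr_norm_centred _ _ _ (c' - arith_mean z)
    (sum_sub_arith_mean _ _ z n_gt0).
  have -> : rz%:C ^+ 2 *+ n = \sum_i `|z i - arith_mean z| ^+ 2.
    under eq_bigr do rewrite z_circle.
    by rewrite sumr_const card_ord.
  have -> : r'%:C ^+ 2 *+ n = \sum_(i < n) r'%:C ^+ 2.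
    by rewrite sumr_const card_ord.
  apply: (@le_trans _ _ (\sum_i `|z i - arith_mean z - (c' - arith_mean z)| ^+ 2)).
    by rewrite huygens lerDl mulrn_wge0 // exprn_ge0.
  apply: ler_sum => i _; rewrite opprB addrA subrK lerXn2r ?nnegrE ?normr_ge0 ?ler0c //.
  by apply: z_in_disk; exists i.
move: sum_sqr_le; rewrite lerMn2r eqn0Ngt n_gt0 /=.
by rewrite ler_pXn2r ?nnegrE ?ler0c // lecR.
Qed.
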